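(* Let $g\in\{\delta,\eta\}$ and let $E$ be one of the spaces $C_0^1([0,1],\mathbb{R}^d)$, $W^{1,1}_0([0,1],\mathbb{R}^d)$, $W^{1,2}_0([0,1],\mathbb{R}^d)$, with $E_1$ the corresponding space of scalar functions. Let $\{e_n\}_{n\ge 1}$ be a weakly uniformly dense orthonormal basis in $L_2(0,1)$ consisting of functions from $E_1$ such that $e_n(1)=0$ for all $n\in\mathbb{N}$, and suppose that the sequence $\{e_n\}$ is uniformly bounded. If $Q\in T^2_E$, then $$tr^{\{e_n\},g}_L(Q)=tr^g_L(Q).$$
   Context: Spaces. $W^{1,p}_0([0,1],\mathbb{R}^d)$ is the space of absolutely continuous $\sigma:[0,1]\to\mathbb{R}^d$ with $\sigma(0)=0$ and $\dot\sigma\in L_p((0,1),\mathbb{R}^d)$; $C_0^1([0,1],\mathbb{R}^d)=\{\sigma\in C^1([0,1],\mathbb{R}^d):\sigma(0)=0\}$ (usual norms). Note that no condition is imposed at $t=1$. $E_1$ is the same space with $\mathbb{R}^d$ replaced by $\mathbb{R}$, so that $E=\mathbb{R}^d\otimes E_1$, continuously and densely embedded in $H=\mathbb{R}^d\otimes L_2(0,1)$. $E_0=\{\sigma\in E:\sigma(1)=0\}$. For $p\in\mathbb{R}^d$ and $e\in E_1$, $p\otimes e\in E$ is the function $t\mapsto e(t)p$. Metrics. $\{p_1,\dots,p_d\}$ is an orthonormal basis of $\mathbb{R}^d$; in this basis $\delta$ is the Euclidean metric $\mathrm{diag}(1,\dots,1)$ and $\eta$ is the Minkowski metric $\mathrm{diag}(1,-1,\dots,-1)$.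 $g^{\mu\nu}$ is the inverse matrix of $g_{\mu\nu}$. Repeated upper and lower indices are summed. Continuous bilinear functionals on $E\times E$ are identified with elements of $L(E,E^\ast)$ by $Q(u,v)=\langle Qu,v\rangle$. Lévy trace generated by a basis. For $T\in L(E,E^\ast)$, $$tr^{\{e_n\},g}_L(T)=\lim_{n\to\infty}\frac1n\sum_{k=1}^n\Big(\langle T(p_1\otimes e_k),p_1\otimes e_k\rangle+\epsilon_g\sum_{\mu=2}^d\langle T(p_\mu\otimes e_k),p_\mu\otimes e_k\rangle\Big),$$ where $\epsilon_\delta=1$, $\epsilon_\eta=-1$; its domain is the set of $T$ for which the limit exists. Lévy trace as an integral functional. $T^2_E$ is the space of continuous bilinear functionals $Q$ on $E\times E$ whose restriction to $E_0\times E_0$ has the form $$Q(u,v)=\int_0^1\!\!\int_0^1 Q^V_{\mu\nu}(t,s)u^\mu(t)v^\nu(s)\,dt\,ds+\int_0^1Q^L_{\mu\nu}(t)u^\mu(t)v^\nu(t)\,dt+\frac12\int_0^1Q^S_{\mu\nu}(t)\big(\dot u^\mu(t)v^\nu(t)+\dot v^\mu(t)u^\nu(t)\big)dt,$$ with $Q^V_{\mu\nu}\in L_1([0,1]^2,\mathbb{R})$, $Q^L_{\mu\nu}\in L_1([0,1],\mathbb{R})$, $Q^S_{\mu\nu}\in L_\infty([0,1],\mathbb{R})$, $Q^L_{\mu\nu}=Q^L_{\nu\mu}$, $Q^S_{\mu\nu}=-Q^S_{\nu\mu}$. On $T^2_E$ one sets $tr^g_LQ=\int_0^1Q^L_{\mu\nu}(t)g^{\mu\nu}\,dt$.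 An orthonormal basis $\{e_n\}$ of $L_2(0,1)$ is weakly uniformly dense if for every $h\in L_\infty[0,1]$ $$\lim_{n\to\infty}\int_0^1h(t)\Big(\frac1n\sum_{k=1}^ne_k^2(t)-1\Big)dt=0.$$ Uniformly bounded means $\sup_n\sup_{t\in[0,1]}|e_n(t)|<\infty$. *)

(* Defs.v *)
From HB Require Import structures.
From mathcomp Require Import all_boot all_order all_algebra.
From mathcomp Require Import all_classical all_reals all_analysis.

Set Implicit Arguments.
Unset Strict Implicit.
Unset Printing Implicit Defensive.

Import Order.TTheory GRing.Theory Num.Theory.
Import numFieldNormedType.Exports.

Local Open Scope classical_set_scope.
Local Open Scope ring_scope.

(* Functions on [0, 1] are represented by functions on R of which only the
   restriction to [0, 1] is ever used: the norms below do not see the other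
   values, so a functional continuous for them does not depend on them. *)

Definition in_Lp d (T : measurableType d) (R : realType)
    (mu : {measure set T -> \bar R}) (D : set T) (p : \bar R) (f : T -> R) : Prop :=
  f \_ D \in Lfun mu p.

Definition absolutely_continuous01 (R : realType) (V : normedModType R)
    (f : R -> V) : Prop :=
  forall eps : R, 0 < eps -> exists2 delta : R, 0 < delta &
    forall (n : nat) (a b : 'I_n -> R),
      (forall i, 0 <= a i /\ a i <= b i /\ b i <= 1) ->
      trivIset setT (fun i => `]a i, b i[%classic) ->
      \sum_(i < n) (b i - a i) < delta ->
      \sum_(i < n) `|f (b i) - f (a i)| < eps.

Definition Lp_norm (R : realType) (V : normedModType R) (p : \bar R)
    (f : R -> V) : \bar R :=
  Lnorm (@lebesgue_measure R) p (EFin \o ((fun t => `|f t|) \_ `]0, 1[)).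

(* Borel measurability is the right notion of measurability for V-valued
   functions because V is finite-dimensional in all uses. *)
Definition in_Lp_vec (R : realType) (V : normedModType R) (p : \bar R)
    (f : R -> V) : Prop :=
  measurable_fun (`]0, 1[ : set R) (f : R -> g_sigma_algebraType (@open V)) /\
  in_Lp (@lebesgue_measure R) `]0, 1[ p (fun t => `|f t|).

Inductive space_kind := C1_space | W11_space | W12_space.

(* C^1([0, 1], V): by the mean value theorem, differentiability in ]0, 1[ with
   a derivative that extends continuously to [0, 1] gives the one-sided
   derivatives at the end points. *)
Definition C1_on01 (R : realType) (V : normedModType R) (f : R -> V) : Prop :=
  {within `[0, 1], continuous f} /\
  exists2 df : R -> V, {within `[0, 1], continuous df} &
    forall t : R, t \in `]0, 1[ -> is_derive t 1 f (df t).

Definition W1p_on01 (R : realType) (V : normedModType R) (p : \bar R)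
    (f : R -> V) : Prop :=
  absolutely_continuous01 f /\
  exists2 df : R -> V, in_Lp_vec p df &
    {ae @lebesgue_measure R, forall t : R, t \in `]0, 1[ -> is_derive t 1 f (df t)}.

Definition space (R : realType) (K : space_kind) (V : normedModType R) :
    set (R -> V) :=
  [set f | f 0 = 0 /\
    match K with
    | C1_space => C1_on01 f
    | W11_space => W1p_on01 1%:E f
    | W12_space => W1p_on01 2%:E f
    end].

(* derive1 f t is the derivative of f at t where f is derivable, that is, on
   ]0, 1[ for C^1 functions and almost everywhere for W^{1,p} functions; its
   default values elsewhere do not affect the norms.  The supremum of |f'| over
   ]0, 1[ equals the one over [0, 1]. *)
Definition space_norm (R : realType) (K : space_kind) (V : normedModType R)
    (f : R -> V) : \bar R :=
  match K with
  | C1_space =>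
      (ereal_sup [set `|f t|%:E | t in `[0%R, 1%R]] +
       ereal_sup [set `|derive1 f t|%:E | t in `]0%R, 1%R[])%E
  | W11_space => (Lp_norm 1%:E f + Lp_norm 1%:E (derive1 f))%E
  | W12_space => (Lp_norm 2%:E f + Lp_norm 2%:E (derive1 f))%E
  end.

(* R^d is 'rV[R]_d with d written d.+1 (so d >= 1), with the norm topology of
   the library, and E_1 is the space of scalar functions. *)
Definition spaceE (R : realType) (K : space_kind) (d : nat) :
  set (R -> 'rV[R]_d.+1) := @space R K 'rV[R]_d.+1.

Definition spaceE0 (R : realType) (K : space_kind) (d : nat) :
  set (R -> 'rV[R]_d.+1) := [set u | spaceE K u /\ u 1 = 0].

Definition spaceE1 (R : realType) (K : space_kind) : set (R -> R) :=
  @space R K R^o.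

Definition tens (R : realType) (d : nat) (v : 'rV[R]_d.+1) (e : R -> R) :
  R -> 'rV[R]_d.+1 := fun t => e t *: v.

Definition bilinear_on (R : realType) (V : normedModType R)
    (E : set (R -> V)) (Q : (R -> V) -> (R -> V) -> R) : Prop :=
  (forall (a : R) u u' v, E u -> E u' -> E v ->
     Q (a *: u + u') v = a * Q u v + Q u' v) /\
  (forall (a : R) u v v', E u -> E v -> E v' ->
     Q u (a *: v + v') = a * Q u v + Q u v').

Definition continuous_bilinear (R : realType) (K : space_kind) (d : nat)
    (Q : (R -> 'rV[R]_d.+1) -> (R -> 'rV[R]_d.+1) -> R) : Prop :=
  bilinear_on (spaceE K (d := d)) Q /\
  forall u0 v0 : R -> 'rV[R]_d.+1, spaceE K u0 -> spaceE K v0 ->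
  forall eps : R, 0 < eps -> exists2 delta : R, 0 < delta &
    forall u v : R -> 'rV[R]_d.+1, spaceE K u -> spaceE K v ->
      (space_norm K (u - u0)%R < delta%:E)%E ->
      (space_norm K (v - v0)%R < delta%:E)%E ->
      `|Q u v - Q u0 v0| < eps.

Definition orthonormal_tuple (R : realType) (d : nat)
    (p : d.+1.-tuple 'rV[R]_d.+1) : Prop :=
  forall i j : 'I_d.+1, \sum_k tnth p i ord0 k * tnth p j ord0 k = (i == j)%:R.

Inductive metric_kind := Euclidean | Minkowski.

Definition metric_sign (R : realType) (g : metric_kind) : R :=
  match g with Euclidean => 1 | Minkowski => -1 end.

(* The matrix g_{mu nu} in the basis p_1, ..., p_d; the index 1 is ord0. *)
Definition metric_mx (R : realType) (d : nat) (g : metric_kind) : 'M[R]_d.+1 :=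
  diag_mx (\row_(mu < d.+1) (if mu == ord0 then 1 else metric_sign R g)).

Record kernels (R : realType) (d : nat) := Kernels {
  kerV : 'I_d.+1 -> 'I_d.+1 -> R -> R -> R ;
  kerL : 'I_d.+1 -> 'I_d.+1 -> R -> R ;
  kerS : 'I_d.+1 -> 'I_d.+1 -> R -> R }.

(* Equalities between integrable kernels are equalities almost everywhere. *)
Definition admissible_kernels (R : realType) (d : nat) (k : kernels R d) : Prop :=
  let mu := @lebesgue_measure R in
  (forall i j,
     in_Lp (mu \x mu)%E (`[0, 1] `*` `[0, 1]) 1%:E (fun z => kerV k i j z.1 z.2) /\
     in_Lp mu `[0, 1] 1%:E (kerL k i j) /\
     in_Lp mu `[0, 1] +oo%E (kerS k i j)) /\
  (forall i j, {ae mu, forall t, t \in `[0, 1] -> kerL k i j t = kerL k j i t}) /\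
  (forall i j, {ae mu, forall t, t \in `[0, 1] -> kerS k i j t = - kerS k j i t}).

(* Upper indices are coordinates in the basis p: u^i = coord p i \o u. *)
Definition kernel_form (R : realType) (d : nat) (p : d.+1.-tuple 'rV[R]_d.+1)
    (k : kernels R d) (u v : R -> 'rV[R]_d.+1) : R :=
  let mu := @lebesgue_measure R in
  \int[(mu \x mu)%E]_(z in `[0, 1] `*` `[0, 1])
     (\sum_i \sum_j kerV k i j z.1 z.2 * coord p i (u z.1) * coord p j (v z.2))
  + \int[mu]_(t in `[0, 1])
     (\sum_i \sum_j kerL k i j t * coord p i (u t) * coord p j (v t))
  + 2^-1 * \int[mu]_(t in `[0, 1])
     (\sum_i \sum_j kerS k i j t *
        (derive1 (coord p i \o u) t * coord p j (v t)
         + derive1 (coord p i \o v) t * coord p j (u t))).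

Definition represents (R : realType) (K : space_kind) (d : nat)
    (p : d.+1.-tuple 'rV[R]_d.+1) (k : kernels R d)
    (Q : (R -> 'rV[R]_d.+1) -> (R -> 'rV[R]_d.+1) -> R) : Prop :=
  admissible_kernels k /\
  forall u v : R -> 'rV[R]_d.+1, spaceE0 K u -> spaceE0 K v -> Q u v = kernel_form p k u v.

Definition T2E (R : realType) (K : space_kind) (d : nat)
    (p : d.+1.-tuple 'rV[R]_d.+1) :
    set ((R -> 'rV[R]_d.+1) -> (R -> 'rV[R]_d.+1) -> R) :=
  [set Q | continuous_bilinear K Q /\ exists k : kernels R d, represents K p k Q].

Definition levy_trace_int (R : realType) (d : nat) (g : metric_kind)
    (k : kernels R d) : R :=
  \int[@lebesgue_measure R]_(t in `[0, 1])
    (\sum_i \sum_j kerL k i j t * invmx (metric_mx R d g) i j).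

(* Sequences indexed by n >= 1 in the text start here at index 0, so that the
   n-th mean runs over the first n terms e 0, ..., e n.-1. *)
Definition levy_means (R : realType) (d : nat) (p : d.+1.-tuple 'rV[R]_d.+1)
    (e : nat -> R -> R) (g : metric_kind)
    (Q : (R -> 'rV[R]_d.+1) -> (R -> 'rV[R]_d.+1) -> R) (n : nat) : R :=
  n%:R^-1 * \sum_(k < n)
    (Q (tens (tnth p ord0) (e k)) (tens (tnth p ord0) (e k))
     + metric_sign R g * \sum_(i < d.+1 | i != ord0)
         Q (tens (tnth p i) (e k)) (tens (tnth p i) (e k))).

Definition levy_trace_dom (R : realType) (d : nat)
    (p : d.+1.-tuple 'rV[R]_d.+1) (e : nat -> R -> R) (g : metric_kind)
    (Q : (R -> 'rV[R]_d.+1) -> (R -> 'rV[R]_d.+1) -> R) : Prop :=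
  cvgn (levy_means p e g Q).

Definition levy_trace (R : realType) (d : nat)
    (p : d.+1.-tuple 'rV[R]_d.+1) (e : nat -> R -> R) (g : metric_kind)
    (Q : (R -> 'rV[R]_d.+1) -> (R -> 'rV[R]_d.+1) -> R) : R :=
  limn (levy_means p e g Q).

Definition L2_dot (R : realType) (f h : R -> R) : R :=
  \int[@lebesgue_measure R]_(t in `[0, 1]) (f t * h t).

Definition L2_orthonormal_basis (R : realType) (e : nat -> R -> R) : Prop :=
  (forall n, in_Lp (@lebesgue_measure R) `[0, 1] 2%:E (e n)) /\
  (forall m n, L2_dot (e m) (e n) = (m == n)%:R) /\
  (forall f : R -> R, in_Lp (@lebesgue_measure R) `[0, 1] 2%:E f ->
     Lp_norm 2%:E ((fun t => f t - \sum_(k < n) L2_dot f (e k) * e k t) : R -> R^o)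
       @[n --> \oo] --> 0%E).

Definition weakly_uniformly_dense (R : realType) (e : nat -> R -> R) : Prop :=
  forall h : R -> R, in_Lp (@lebesgue_measure R) `[0, 1] +oo%E h ->
    \int[@lebesgue_measure R]_(t in `[0, 1])
      (h t * (n%:R^-1 * (\sum_(k < n) e k t ^+ 2) - 1)) @[n --> \oo] --> (0 : R).

Definition uniformly_bounded01 (R : realType) (e : nat -> R -> R) : Prop :=
  exists M : R, forall n (t : R), t \in `[0, 1] -> `|e n t| <= M.

(* Main.v *)
Require Import Defs.
From HB Require Import structures.
From mathcomp Require Import all_boot all_order all_algebra.
From mathcomp Require Import all_classical all_reals all_analysis.
From mathcomp Require Import measurable_realfun ess_sup_inf ring lra.

(* On p_i (x) e_k the S-term of Q vanishes, S_ii being zero almost everywhere by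
   antisymmetry, so the k-th term of the trace is
   iint V_ii(t,s) e_k(t) e_k(s) + int L_ii e_k^2, weighted by g^ii.  For bounded
   h in place of V_ii, the means of the first integral tend to 0 because
   phi_n = (1/n) sum_{k<n} e_k(t) e_k(s) has int phi_n^2 = 1/n by orthonormality
   and Fubini; for bounded h in place of L_ii, the means of the second tend to
   int h by weak uniform density.  As the weights phi_n and (1/n) sum e_k^2 are
   uniformly bounded, truncation extends both limits to integrable kernels. *)

Set Implicit Arguments.
Unset Strict Implicit.
Unset Printing Implicit Defensive.

Import Order.TTheory GRing.Theory Num.Theory.
Import numFieldNormedType.Exports.

Local Open Scope classical_set_scope.
Local Open Scope ring_scope.

(** * Null sets, truncation, and integrals against bounded weights *)

Section measure.
Context d (T : measurableType d) (R : realType).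
Variable mu : {measure set T -> \bar R}.
Import HBNNSimple.

(* f need not be measurable: the simple functions below f are, and they vanish
   almost everywhere. *)
Lemma ge0_integral_ae0 (f : T -> \bar R) : (forall x, 0 <= f x)%E ->
  {ae mu, forall x, f x = 0%E} -> (\int[mu]_x f x = 0)%E.
Proof.
move=> f0 fae; apply/eqP; rewrite eq_le integral_ge0// andbT ge0_integralTE//.
apply: ge_ereal_sup => _ [h /= hf <-].
rewrite -integralT_nnsfun (@ge0_ae_eq_integral _ _ _ _ setT _ (cst 0%E))//.
- by rewrite integral0.
- exact/measurable_EFinP.
- by move=> x _; rewrite lee_fin.
- apply: filterS fae => x fx0 _; apply/eqP; rewrite eq_le.
  by have := hf x; rewrite fx0 => ->; rewrite lee_fin; exact: fun_ge0.
Qed.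

(** Positive and negative parts both vanish almost everywhere. This serves the S-term, whose
    derivative factors come with no measurability statement. *)
Lemma Rintegral_ae0 (D : set T) (f : T -> R) :
  {ae mu, forall x, D x -> f x = 0} -> \int[mu]_(x in D) f x = 0.
Proof.
move=> fae; rewrite Rintegral_mkcond /Rintegral integralE.
have fD0 : {ae mu, forall x, (f \_ D) x = 0}.
  by apply: filterS fae => x fx0; rewrite patchE; case: ifP => // /set_mem/fx0.
rewrite !ge0_integral_ae0 ?sube0//.
- by apply: filterS fD0 => x fx0; rewrite funenegE /= fx0 oppr0 maxxx.
- by apply: filterS fD0 => x fx0; rewrite funeposE /= fx0 maxxx.
Qed.

Lemma measurable_Rintegrable (D : set T) (f : T -> R) (C : R) : measurable D ->
  (mu D < +oo)%E -> measurable_fun D f -> (forall x, D x -> `|f x| <= C) ->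
  mu.-integrable D (EFin \o f).
Proof.
move=> mD muD mf fC; apply: measurable_bounded_integrable => //.
exists C; split; rewrite ?num_real// => c Cc x Dx /=.
by rewrite (le_trans (fC _ Dx))// ltW.
Qed.

Lemma integrable_sumr (I : Type) (s : seq I) (D : set T) (F : I -> T -> R) :
  measurable D -> (forall i, mu.-integrable D (EFin \o F i)) ->
  mu.-integrable D (EFin \o (fun x => \sum_(i <- s) F i x)).
Proof.
move=> mD iF.
rewrite (_ : _ \o _ = fun x => (\sum_(i <- s) (F i x)%:E)%E).
  by apply: integrable_sum => // i _; exact: iF.
by apply/funext => x /=; rewrite sumEFin.
Qed.

Lemma Rintegral_sum (I : Type) (s : seq I) (D : set T) (F : I -> T -> R) :
  measurable D -> (forall i, mu.-integrable D (EFin \o F i)) ->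
  \int[mu]_(x in D) (\sum_(i <- s) F i x) =
  \sum_(i <- s) \int[mu]_(x in D) F i x.
Proof.
move=> mD iF; elim: s => [|i s ih].
  rewrite big_nil; under eq_Rintegral do rewrite big_nil.
  by rewrite Rintegral_cst// mul0r.
rewrite big_cons -ih -RintegralD//; last exact: integrable_sumr.
by apply: eq_Rintegral => x _; rewrite big_cons.
Qed.

Lemma integrableM_bounded (D : set T) (f g : T -> R) (C : R) : measurable D ->
  mu.-integrable D (EFin \o f) -> measurable_fun D g ->
  (forall x, D x -> `|g x| <= C) -> mu.-integrable D (EFin \o (fun x => f x * g x)).
Proof.
move=> mD fi mg gC.
have := @integrableMl _ _ _ mu _ mD _ g fi mg.
apply; exists C; split; rewrite ?num_real// => c Cc x Dx /=.
by rewrite (le_trans (gC _ Dx))// ltW.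
Qed.

Definition truncate (f : T -> R) (N : R) (x : T) : R :=
  if `|f x| <= N then f x else 0.

Lemma measurable_truncate (D : set T) (f : T -> R) (N : R) : measurable D ->
  measurable_fun D f -> measurable_fun D (truncate f N).
Proof.
move=> mD mf.
apply: measurable_fun_if => //.
- by apply: measurable_fun_ler => //; exact: measurableT_comp.
- exact: measurable_funS mf.
Qed.

(** Dominated convergence with majorant |f|: at each x the difference is 0 as soon as n >= |f x|. *)
Lemma cvg_Rintegral_truncate (D : set T) (f : T -> R) : measurable D ->
  mu.-integrable D (EFin \o f) ->
  \int[mu]_(x in D) `|f x - truncate f n%:R x| @[n --> \oo] --> (0 : R).
Proof.
move=> mD fi.
have mf : measurable_fun D f by move/measurable_int/measurable_EFinP: fi.
have [] := @dominated_convergence _ _ _ mu D mD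
  (fun n x => `|f x - truncate f n%:R x|%:E) (cst 0%E) (fun x => `|f x|%:E).
- move=> n; apply/measurable_EFinP/measurableT_comp => //.
  by apply: measurable_funB => //; exact: measurable_truncate.
- by [].
- apply: aeW => x Dx; apply/fine_cvgP; split; first exact: nearW.
  apply: cvg_near_cst; near=> n; rewrite /= /truncate ifT ?subrr ?normr0//.
  by near: n; exact: nbhs_infty_ger.
- exact: integrable_norm.
- apply: aeW => x n Dx /=; rewrite lee_fin normr_id /truncate.
  by case: ifP => _; rewrite ?subrr ?normr0 ?subr0.
- move=> _ _; rewrite integral0.
  by move=> /fine_cvgP[].
Unshelve. all: by end_near. Qed.

(** A density argument: the functionals f |-> int f phi_n are uniformly bounded on L_1, and
    truncations of f approximate it in L_1 by bounded functions. *)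
Lemma cvg_Rintegral_mul_bounded (D : set T) (f : T -> R)
    (phi : nat -> T -> R) (C : R) :
  measurable D -> (mu D < +oo)%E -> mu.-integrable D (EFin \o f) ->
  (forall n, measurable_fun D (phi n)) ->
  (forall n x, D x -> `|phi n x| <= C) ->
  (forall (h : T -> R) (N : R), measurable_fun D h ->
    (forall x, D x -> `|h x| <= N) ->
    \int[mu]_(x in D) (h x * phi n x) @[n --> \oo] --> (0 : R)) ->
  \int[mu]_(x in D) (f x * phi n x) @[n --> \oo] --> (0 : R).
Proof.
move=> mD muD fi mphi phiC hcvg.
have mf : measurable_fun D f by move/measurable_int/measurable_EFinP: fi.
apply/cvgr0Pnorm_lt => eps eps0.
(* A positive bound for all [phi n], so that division by it is possible even when C = 0. *)
pose c := `|C| + 1.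
have c0 : 0 < c by rewrite ltr_wpDl.
have : \forall N \near \oo,
    \int[mu]_(x in D) `|f x - truncate f N%:R x| < eps / 2 / c.
  have /cvgr0Pnorm_lt/(_ (eps / 2 / c)) := cvg_Rintegral_truncate mD fi.
  have e2c : 0 < eps / 2 / c by rewrite divr_gt0// divr_gt0.
  move=> /(_ e2c); apply: filterS => N; apply: le_lt_trans; exact: ler_norm.
case=> N _ /(_ N (leqnn _)) /= HN.
set h := truncate f N%:R in HN.
have mh : measurable_fun D h by exact: measurable_truncate.
have hN x : D x -> `|h x| <= N%:R.
  by rewrite /h /truncate; case: ifP => // _; rewrite normr0.
have hi : mu.-integrable D (EFin \o h) by exact: measurable_Rintegrable hN.
have fhi : mu.-integrable D (EFin \o (fun x => f x - h x)) by exact: (integrableB mD fi hi).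
have fh n : \int[mu]_(x in D) (f x * phi n x) =
    \int[mu]_(x in D) ((f x - h x) * phi n x) +
    \int[mu]_(x in D) (h x * phi n x).
  rewrite -RintegralD//.
  - by apply: eq_Rintegral => x _; rewrite mulrBl subrK.
  - exact: integrableM_bounded (phiC n).
  - exact: integrableM_bounded (phiC n).
have /cvgr0Pnorm_lt/(_ (eps / 2)) := hcvg _ _ mh hN.
rewrite divr_gt0// => /(_ isT); apply: filterS => n hn.
rewrite fh (le_lt_trans (ler_normD _ _))// [eps]splitr ltrD//.
have fhphi := integrableM_bounded mD fhi (mphi n) (phiC n).
apply: le_lt_trans (le_normr_Rintegral mD fhphi) _.
rewrite ltr_pdivlMr// in HN; apply: le_lt_trans HN.
rewrite -RintegralZr//; last exact: integrable_norm.
apply: le_Rintegral => //.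
- exact: integrable_norm fhphi.
- by have := integrableZr mD c (integrable_norm fhi).
- move=> x Dx; rewrite normrM ler_wpM2l// (le_trans (phiC n x Dx))// /c.
  by rewrite (le_trans (ler_norm _))// lerDl.
Qed.

(** Convergence to 0 in L_2 forces weak convergence to 0. A weighted Young inequality plays the part
    of Cauchy-Schwarz: the weight c, independent of n, makes the h^2 term small, and then large n
    makes the phi_n^2 term small. *)
Lemma cvg_Rintegral_mul_sqr (D : set T) (h : T -> R) (phi : nat -> T -> R)
    (C N : R) :
  measurable D -> (mu D < +oo)%E ->
  (forall n, measurable_fun D (phi n)) ->
  (forall n x, D x -> `|phi n x| <= C) ->
  measurable_fun D h -> (forall x, D x -> `|h x| <= N) ->
  \int[mu]_(x in D) (phi n x ^+ 2) @[n --> \oo] --> (0 : R) ->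
  \int[mu]_(x in D) (h x * phi n x) @[n --> \oo] --> (0 : R).
Proof.
move=> mD muD mphi phiC mh hN phi2.
apply/cvgr0Pnorm_lt => eps eps0.
(* N^2 mu(D) bounds the integral of h^2; adding 1 makes A positive, and c = eps / (2 A) gives c N^2
   mu(D) <= eps / 2. *)
pose A := N ^+ 2 * fine (mu D) + 1.
have A0 : 0 < A by rewrite ltr_wpDl// mulr_ge0 ?sqr_ge0 ?fine_ge0.
pose c := eps / 2 / A.
have c0 : 0 < c by rewrite divr_gt0// divr_gt0.
(* The factor c compensates the c^-1 in front of phi_n^2 below. *)
have /cvgr0Pnorm_lt/(_ (c * (eps / 2))) := phi2.
rewrite mulr_gt0 ?divr_gt0// => /(_ isT); apply: filterS => n Hn.
have phi2C x : D x -> `|phi n x ^+ 2| <= C ^+ 2.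
  by move=> Dx; rewrite normrX ler_sqr ?nnegrE ?phiC// (le_trans _ (phiC n x Dx)).
have mphi2 : measurable_fun D (fun x => phi n x ^+ 2) by exact: measurable_funX.
have iphi2 := measurable_Rintegrable mD muD mphi2 phi2C.
have ihphi : mu.-integrable D (EFin \o (fun x => h x * phi n x)).
  apply: integrableM_bounded (phiC n) => //.
  exact: measurable_Rintegrable hN.
have iN : mu.-integrable D (EFin \o cst (c * N ^+ 2)).
  exact: (@measurable_Rintegrable _ _ `|c * N ^+ 2|).
have iphi2c : mu.-integrable D (EFin \o (fun x => c^-1 * phi n x ^+ 2)).
  by have := integrableZl mD c^-1 iphi2.
apply: le_lt_trans (le_normr_Rintegral mD ihphi) _.
(* |h phi_n| <= c h^2 + phi_n^2 / c *)
apply: (@le_lt_trans _ _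
    (\int[mu]_(x in D) (c * N ^+ 2 + c^-1 * phi n x ^+ 2))).
  apply: le_Rintegral => //.
  - exact: integrable_norm ihphi.
  - exact: (integrableD mD iN iphi2c).
  - move=> x Dx; rewrite normrM.
    have h2 : `|h x| ^+ 2 <= N ^+ 2.
      by rewrite ler_sqr ?nnegrE ?hN// (le_trans _ (hN x Dx)).
    rewrite -(real_normK (num_real (phi n x))).
    move: (`|h x|) (`|phi n x|) h2 => a b ab.
    apply: (@le_trans _ _ (c * a ^+ 2 + c^-1 * b ^+ 2)); last first.
      by rewrite lerD2r ler_wpM2l// ltW.
    (* Completing the square in c a^2 + b^2 / c - a b leaves the nonnegative remainder (3/4) b^2 /
       c. *)
    rewrite -subr_ge0 [leRHS](_ : _ =
        c * (a - c^-1 * b / 2) ^+ 2 + 3 / 4 * (c^-1 * b ^+ 2)); last first.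
      by field; rewrite gt_eqF.
    have cb0 : 0 <= c^-1 * b ^+ 2.
      by rewrite mulr_ge0 ?sqr_ge0// invr_ge0 ltW.
    by rewrite addr_ge0// mulr_ge0 ?sqr_ge0 ?(ltW c0).
rewrite RintegralD// Rintegral_cst// RintegralZl// [ltRHS]splitr ler_ltD//.
- rewrite -mulrA /c mulrAC ler_pdivrMr// ler_wpM2l ?divr_ge0 ?ltW//.
  by rewrite ltrDl.
- rewrite ltr_pdivrMl//; apply: le_lt_trans Hn; exact: ler_norm.
Qed.

End measure.

(** * Fubini for products of functions of separate variables *)

Section product.
Context d1 d2 (T1 : measurableType d1) (T2 : measurableType d2) (R : realType).
Variables (m1 : {sigma_finite_measure set T1 -> \bar R})
  (m2 : {sigma_finite_measure set T2 -> \bar R}).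

Lemma Rintegral_prodM (D1 : set T1) (D2 : set T2) (f : T1 -> R) (g : T2 -> R) :
  measurable D1 -> measurable D2 ->
  m1.-integrable D1 (EFin \o f) -> m2.-integrable D2 (EFin \o g) ->
  \int[(m1 \x m2)%E]_(z in D1 `*` D2) (f z.1 * g z.2) =
  \int[m1]_(x in D1) f x * \int[m2]_(y in D2) g y.
Proof.
move=> mD1 mD2 /(integrable_mkcond _ mD1) + /(integrable_mkcond _ mD2).
rewrite !restrict_EFin !(Rintegral_mkcond _ D1) !(Rintegral_mkcond _ D2) => fi gi.
(* Extension by zero turns the rectangle into the whole product space, since the zero extension of
   the product is the product of the zero extensions. *)
rewrite Rintegral_mkcond; set F := f \_ D1 in fi *; set G := g \_ D2 in gi *.
rewrite (_ : _ \_ _ = fun z => F z.1 * G z.2); last first.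
  apply/funext => -[x y]; rewrite /F /G !patchE /= in_setX /=.
  by case: (x \in D1); case: (y \in D2); rewrite ?mulr0 ?mul0r.
have mF : measurable_fun setT F by move/measurable_int/measurable_EFinP : fi.
have mG : measurable_fun setT G by move/measurable_int/measurable_EFinP : gi.
have mFG : measurable_fun setT (fun z : T1 * T2 => (F z.1 * G z.2)%:E).
  apply/measurable_EFinP/measurable_funM.
  - exact: (measurableT_comp mF measurable_fst).
  - exact: (measurableT_comp mG measurable_snd).
have iFG : (m1 \x m2)%E.-integrable setT
    (fun z : T1 * T2 => (F z.1 * G z.2)%:E).
  (* Tonelli: the iterated integral of |F G| is the product of two finite L_1 norms. *)
  apply/(integrable12ltyP m1 m2 mFG).
  rewrite [ltLHS](_ : _ =
    (\int[m1]_x (`|F x|%:E * \int[m2]_y `|G y|%:E))%E); last first.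
    apply: eq_integral => x _; rewrite -ge0_integralZl//.
    - by apply: eq_integral => y _ /=; rewrite normrM EFinM.
    - exact/measurable_EFinP/measurableT_comp.
  rewrite -(fineK (integrable_fin_num measurableT (integrable_norm gi))).
  have := integrableZr measurableT _ (integrable_norm fi).
  by move=> /(_ _)/(integrable_lty measurableT); apply.
rewrite /Rintegral -(integral12_prod_meas1 iFG) /fubini_F /=.
have fifin := integrable_fin_num measurableT fi.
have gifin := integrable_fin_num measurableT gi.
rewrite -fineM//; congr fine; have giE := fineK gifin.
(* The finite integral of G is written as a real number so that it can move through the outer
   integral as a scalar. *)
rewrite -[X in (_ * X)%E]giE -integralZr//.
by apply: eq_integral => x _; rewrite /= giE -integralZl.
Qed.

End product.

(** * Limits of means for a uniformly bounded sequence of functions *)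

Lemma ler_norm_mean (R : realFieldType) (n : nat) (a : nat -> R) (C : R) :
  (forall k, `|a k| <= C) -> `|n%:R^-1 * \sum_(k < n) a k| <= C.
Proof.
move=> aC; have C0 : 0 <= C := le_trans (normr_ge0 _) (aC 0%N).
rewrite normrM normfV normr_nat.
(* The empty mean is 0 because the inverse of 0 is 0; 0 <= C comes from the bound on [a 0]. *)
have [->|n0] := eqVneq n 0%N; first by rewrite invr0 mul0r.
rewrite ler_pdivrMl ?ltr0n ?lt0n//.
apply: le_trans (ler_norm_sum _ _ _) _.
apply: le_trans (ler_sum _ (G := fun=> C) _) _; first by move=> k _; exact: aC.
by rewrite sumr_const card_ord mulr_natl.
Qed.

Section means.
Context d (T : measurableType d) (R : realType).
Variables (D : set T) (e : nat -> T -> R) (M : R).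
Hypothesis mD : measurable D.
Hypothesis me : forall n, measurable_fun D (e n).
Hypothesis eM : forall n x, D x -> `|e n x| <= M.

(** The functions e_k(t) e_k(s) are orthonormal on the square, so their n-th mean has squared L_2
    norm n / n^2 = 1 / n. This settles bounded V, and the uniform bound M^2 on the means extends it
    to integrable V. *)
Lemma cvg_diagonal_means (m : {sigma_finite_measure set T -> \bar R})
    (V : T * T -> R) :
  (m D < +oo)%E ->
  (forall i j, \int[m]_(x in D) (e i x * e j x) = (i == j)%:R) ->
  (m \x m)%E.-integrable (D `*` D) (EFin \o V) ->
  n%:R^-1 *
    \sum_(k < n) \int[(m \x m)%E]_(z in D `*` D) (V z * (e k z.1 * e k z.2))
    @[n --> \oo] --> (0 : R).
Proof.
move=> mDoo eo iV.
have mDD : measurable (D `*` D) by exact: measurableX.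
have mDDoo : ((m \x m)%E (D `*` D) < +oo)%E.
  by rewrite product_measure1E//= lte_mul_pinfty// ge0_fin_numE.
pose ee (k : nat) (z : T * T) := e k z.1 * e k z.2.
pose mean n z := n%:R^-1 * \sum_(k < n) ee k z.
have mee k : measurable_fun (D `*` D) (ee k).
  apply: measurable_funM.
  - apply: (measurable_comp mD _ (me k)) => //; last exact: measurable_funTS.
    by move=> _ [z [Dz1 _] <-].
  - apply: (measurable_comp mD _ (me k)) => //; last exact: measurable_funTS.
    by move=> _ [z [_ Dz2] <-].
have eeM k z : (D `*` D) z -> `|ee k z| <= M ^+ 2.
  by move=> [Dz1 Dz2]; rewrite normrM expr2 ler_pM ?eM.
have mmean n : measurable_fun (D `*` D) (mean n).
  by apply: measurable_funM => //; exact: measurable_sum.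
have meanM n z : (D `*` D) z -> `|mean n z| <= M ^+ 2.
  by move=> Dz; apply: (ler_norm_mean n (a := ee ^~ z)) => k; exact: eeM.
(* By linearity the mean of the integrals is one integral of V against [mean n]. *)
rewrite [X in X @ _ --> _](_ : _ = fun n =>
    \int[(m \x m)%E]_(z in D `*` D) (V z * mean n z)); last first.
  apply/funext => n.
  have iVee (k : 'I_n) :
      (m \x m)%E.-integrable (D `*` D) (EFin \o (fun z => V z * ee k z)).
    exact: integrableM_bounded (eeM k).
  rewrite -(Rintegral_sum (index_enum 'I_n)
    (F := fun (k : 'I_n) z => V z * ee k z))//.
  rewrite -RintegralZl//; last exact: integrable_sumr.
  by apply: eq_Rintegral => z _; rewrite /mean mulrCA [in RHS]mulr_sumr.
apply: (cvg_Rintegral_mul_bounded (C := M ^+ 2)) => // h N mh hN.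
apply: (cvg_Rintegral_mul_sqr (C := M ^+ 2) (N := N)) => //.
rewrite [X in X @ _ --> _](_ : _ = fun n => n%:R^-1); last first.
  apply/funext => n.
  have ieeee (i j : nat) : (m \x m)%E.-integrable (D `*` D)
      (EFin \o (fun z => ee i z * ee j z)).
    apply: (@measurable_Rintegrable _ _ _ _ _ _ (M ^+ 2 * M ^+ 2)) => //.
    - exact: measurable_funM.
    - by move=> z Dz; rewrite normrM ler_pM ?eeM.
  have isum (i : nat) : (m \x m)%E.-integrable (D `*` D)
      (EFin \o (fun z => \sum_(j < n) ee i z * ee j z)).
    exact: (integrable_sumr (index_enum 'I_n)
      (F := fun (j : 'I_n) z => ee i z * ee j z)).
  have iee i j : m.-integrable D (EFin \o (fun x => e i x * e j x)).
    apply: (@measurable_Rintegrable _ _ _ _ _ _ (M ^+ 2)) => //.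
    - exact: measurable_funM.
    - by move=> x Dx; rewrite normrM expr2 ler_pM ?eM.
  (* The square of the mean is expanded into a double sum, whose off-diagonal integrals vanish. *)
  transitivity (n%:R ^- 2 * \sum_(i < n) \sum_(j < n)
     \int[(m \x m)%E]_(z in D `*` D) (ee i z * ee j z)).
    under [in RHS]eq_bigr => i _.
      rewrite -(Rintegral_sum (index_enum 'I_n)
        (F := fun (j : 'I_n) z => ee i z * ee j z))//; over.
    rewrite -(Rintegral_sum (index_enum 'I_n)
      (F := fun (i : 'I_n) z => \sum_(j < n) ee i z * ee j z))//.
    rewrite -RintegralZl//; last first.
      exact: (integrable_sumr (index_enum 'I_n)
        (F := fun (i : 'I_n) z => \sum_(j < n) ee i z * ee j z)).
    apply: eq_Rintegral => z _; rewrite /mean exprMn exprVn.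
    congr (_ * _); rewrite expr2 mulr_suml; apply: eq_bigr => i _.
    by rewrite mulr_sumr.
  have eeE i j : \int[(m \x m)%E]_(z in D `*` D) (ee i z * ee j z) =
      (i == j)%:R * (i == j)%:R.
    rewrite -!eo -Rintegral_prodM//; apply: eq_Rintegral => z _.
    by rewrite /ee mulrACA.
  under eq_bigr => i _.
    rewrite (bigD1 i)//= eeE eqxx mulr1 big1 ?addr0; last first.
      by move=> j ji; rewrite eeE eq_sym val_eqE (negbTE ji) mulr0.
    over.
  rewrite sumr_const card_ord.
  have [->|n0] := eqVneq n 0%N; first by rewrite invr0 expr0n /= mulr0n mulr0.
  by rewrite expr2 invfM -mulrA mulVf ?mulr1// pnatr_eq0.
(* The harmonic sequence is 1 / (n + 1), hence the shift by one. *)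
rewrite -cvg_shiftS; exact: cvg_harmonic.
Qed.

(** Subtracting 1 from the mean of the squares gives a weight bounded by M^2 + 1. The second
    hypothesis is weak uniform density for bounded test functions; truncation carries it over to the
    integrable L. *)
Lemma cvg_sqr_means (m : {measure set T -> \bar R}) (L : T -> R) :
  (m D < +oo)%E ->
  (forall (h : T -> R) (N : R), measurable_fun D h ->
    (forall x, D x -> `|h x| <= N) ->
    \int[m]_(x in D) (h x * (n%:R^-1 * (\sum_(k < n) e k x ^+ 2) - 1))
      @[n --> \oo] --> (0 : R)) ->
  m.-integrable D (EFin \o L) ->
  n%:R^-1 * \sum_(k < n) \int[m]_(x in D) (L x * e k x ^+ 2)
    @[n --> \oo] --> \int[m]_(x in D) L x.
Proof.
move=> mDoo hcvg iL.
pose phi n x := n%:R^-1 * (\sum_(k < n) e k x ^+ 2) - 1.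
have mphi n : measurable_fun D (phi n).
  apply: measurable_funB => //; apply: measurable_funM => //.
  by apply: measurable_sum => k; exact: measurable_funX.
have e2M k x : D x -> `|e k x ^+ 2| <= M ^+ 2.
  by move=> Dx; rewrite normrX !expr2 ler_pM ?eM.
have phiM n x : D x -> `|phi n x| <= M ^+ 2 + 1.
  move=> Dx; rewrite (le_trans (ler_normB _ _))// normr1 lerD2r.
  by apply: (ler_norm_mean n (a := fun k => e k x ^+ 2)) => k; exact: e2M.
have Lphi : \int[m]_(x in D) (L x * phi n x) @[n --> \oo] --> (0 : R).
  exact: (cvg_Rintegral_mul_bounded (C := M ^+ 2 + 1)).
rewrite [X in X @ _ --> _](_ : _ = fun n =>
    \int[m]_(x in D) (L x * phi n x) + \int[m]_(x in D) L x); last first.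
  apply/funext => n.
  have iLe (k : 'I_n) :
      m.-integrable D (EFin \o (fun x => L x * e k x ^+ 2)).
    apply: (integrableM_bounded (g := fun x => e k x ^+ 2) _ _ _ (e2M k)) => //.
    exact: measurable_funX.
  rewrite -[in RHS]RintegralD//; last exact: integrableM_bounded (phiM n).
  rewrite -(Rintegral_sum (index_enum 'I_n)
    (F := fun (k : 'I_n) x => L x * e k x ^+ 2))//.
  rewrite -[in LHS]RintegralZl//; last exact: integrable_sumr.
  apply: eq_Rintegral => x _; rewrite /phi mulrBr mulr1 subrK mulrCA.
  by rewrite [in RHS]mulr_sumr.
rewrite -[X in _ --> X]add0r; exact: cvgD Lphi (cvg_cst _).
Qed.

End means.

(** * Membership of t |-> e(t) v in the vector-valued spaces *)

Section scaled_functions.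
Context (R : realType) (V : normedModType R).

(** The difference quotient is the image of the scalar one under the continuous map x |-> x v. *)
Lemma is_derive_scalel (e : R -> R^o) (v : V) (t : R) (de : R) :
  is_derive t 1 e de -> is_derive t 1 (fun x => e x *: v) (de *: v).
Proof.
move=> ede; have [De] := ede; rewrite /derive => limDe.
have H : h^-1 *: (((fun x => e x *: v) \o shift t) (h *: 1) - e t *: v)
    @[h --> 0^'] --> de *: v.
  rewrite [X in X @ _ --> _](_ : _ = ( *:%R ^~ v) \o
    (fun h => h^-1 *: ((e \o shift t) (h *: 1) - e t))); last first.
    by apply/funext => h /=; rewrite -scalerBl scalerA.
  apply: continuous_cvg; first exact: scalel_continuous.
  by rewrite -limDe.
apply: DeriveDef; last exact: cvg_lim H.
by apply/cvg_ex; exists (de *: v).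
Qed.

Lemma absolutely_continuous01_scalel (e : R -> R^o) (v : V) :
  absolutely_continuous01 e -> absolutely_continuous01 (fun t => e t *: v).
Proof.
move=> ace eps eps0.
(* Adding 1 keeps the divisor of eps positive when v = 0. *)
have c0 : 0 < `|v| + 1 by rewrite ltr_wpDl.
have [delta delta0 He] := ace _ (divr_gt0 eps0 c0).
exists delta => // n a b ab tab sab; have := He n a b ab tab sab.
rewrite ltr_pdivlMr//; apply: le_lt_trans.
rewrite mulr_suml; apply: ler_sum => i _.
by rewrite -scalerBl normrZ ler_wpM2l// lerDl.
Qed.

Lemma in_Lp_vec_scalel (r : R) (e : R -> R^o) (v : V) : 1 <= r ->
  in_Lp_vec r%:E e -> in_Lp_vec r%:E (fun t => e t *: v).
Proof.
move=> r1 [me Le]; split.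
- apply: (@measurability _ _ _ (g_sigma_algebraType (@open V)) _ _
    (@open V)) => //.
  move=> _ [U oU <-].
  (* The preimage of U under t |-> e(t) v is the preimage under e of an open set of scalars. *)
  have := me (measurable_itv _) ((fun x : R^o => x *: v) @^-1` U); apply.
  apply: sub_sigma_algebra; apply: open_comp oU => x _.
  exact: scalel_continuous.
- rewrite /in_Lp (_ : _ \_ _ = `|v| \o* ((fun t => `|e t|) \_ `]0, 1[)).
    exact: Lfun_scale.
  apply/funext => t /=; rewrite !patchE.
  by case: ifP; rewrite ?mul0r// normrZ.
Qed.

Lemma within_continuous_scalel (A : set R) (e : R -> R^o) (v : V) :
  {within A, continuous e} -> {within A, continuous (fun t => e t *: v)}.
Proof.
move=> ce x.
apply: (@continuous_comp _ _ _ (e : subspace A -> R^o) ( *:%R ^~ v)).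
  exact: ce.
exact: scalel_continuous.
Qed.

Lemma space_scalel (K : space_kind) (e : R -> R^o) (v : V) :
  Defs.space K e -> Defs.space K (fun t => e t *: v).
Proof.
case=> e0 He; split; first by rewrite e0 scale0r.
have W1p r : 1 <= r -> W1p_on01 r%:E e -> W1p_on01 r%:E (fun t => e t *: v).
  move=> r1 [ace [de Lde ede]]; split.
    exact: absolutely_continuous01_scalel.
  exists (fun t => de t *: v); first exact: in_Lp_vec_scalel.
  apply: (@filterS _ _ (ae_filter_ringOfSetsType (@lebesgue_measure R))) ede.
  by move=> t + tI => /(_ tI); exact: is_derive_scalel.
case: K He => //; [|exact: W1p|by apply: W1p; rewrite ler1n].
move=> [ce [de cde ede]]; split.
  exact: within_continuous_scalel.
exists (fun t => de t *: v).
  exact: within_continuous_scalel.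
by move=> t /ede; exact: is_derive_scalel.
Qed.

End scaled_functions.

(** The kernels describe Q only on E_0; the condition at t = 1 places the tensors there. *)
Lemma spaceE0_tens (R : realType) (d : nat) (K : space_kind) (v : 'rV[R]_d.+1)
    (e : R -> R) : spaceE1 K e -> e 1 = 0 -> spaceE0 K (tens v e).
Proof. by move=> Ee e1; split; [exact: space_scalel|rewrite /tens e1 scale0r]. Qed.

(** * Coordinates in the orthonormal basis and the form on elementary tensors *)

Lemma orthonormal_free (R : realType) (d : nat) (p : d.+1.-tuple 'rV[R]_d.+1) :
  orthonormal_tuple p -> free p.
Proof.
move=> hp; apply/freeP => k kp0 i.
(* Pairing the vanishing combination with p_i isolates its i-th coefficient. *)
have : \sum_l (\sum_j k j *: p`_j) ord0 l * tnth p i ord0 l = 0.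
  by rewrite kp0 big1// => l _; rewrite mxE mul0r.
under eq_bigr do rewrite summxE mulr_suml.
rewrite exchange_big /= (bigD1 i)//= [X in _ + X]big1 ?addr0; last first.
  move=> j ji; under eq_bigr do rewrite mxE -mulrA -tnth_nth.
  by rewrite -mulr_sumr hp (negbTE ji) mulr0.
under eq_bigr do rewrite mxE -mulrA -tnth_nth.
by rewrite -mulr_sumr hp eqxx mulr1.
Qed.

Lemma coord_tens (R : realType) (d : nat) (p : d.+1.-tuple 'rV[R]_d.+1)
    (e : R -> R) (i j : 'I_d.+1) (t : R) : orthonormal_tuple p ->
  coord p j (tens (tnth p i) e t) = e t * (i == j)%:R.
Proof.
move=> /orthonormal_free pfree.
by rewrite /tens linearZ /= (tnth_nth 0) coord_free.
Qed.

Lemma kernel_form_tens (R : realType) (d : nat) (p : d.+1.-tuple 'rV[R]_d.+1)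
    (k : kernels R d) (e : R -> R) (i : 'I_d.+1) :
  orthonormal_tuple p -> admissible_kernels k ->
  kernel_form p k (tens (tnth p i) e) (tens (tnth p i) e) =
  \int[(@lebesgue_measure R \x @lebesgue_measure R)%E]_
      (z in `[0, 1] `*` `[0, 1]) (kerV k i i z.1 z.2 * (e z.1 * e z.2)) +
  \int[@lebesgue_measure R]_(t in `[0, 1]) (kerL k i i t * e t ^+ 2).
Proof.
move=> hp [_ [_ kS]].
have sum2 (F : 'I_d.+1 -> 'I_d.+1 -> R) :
    (forall a b, (a, b) != (i, i) -> F a b = 0) -> \sum_a \sum_b F a b = F i i.
  move=> F0; rewrite (bigD1 i)//= [X in _ + X]big1 ?addr0; last first.
    by move=> a ai; rewrite big1// => b _; rewrite F0// xpair_eqE (negbTE ai).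
  rewrite (bigD1 i)//= [X in _ + X]big1 ?addr0// => b bi.
  by rewrite F0// xpair_eqE (negbTE bi) andbF.
rewrite /kernel_form [X in _ + _ + X](_ : _ = 0) ?addr0; last first.
  rewrite Rintegral_ae0 ?mulr0//.
  apply: (@filterS _ _ (ae_filter_ringOfSetsType _)) (kS i i) => t Sii tI.
  have {}Sii : kerS k i i t = 0 by have := Sii tI; lra.
  rewrite sum2 ?Sii ?mul0r// => a b.
  rewrite xpair_eqE negb_and => /orP[ai|bi].
  (* Differentiation requires the a-th coordinate to vanish as a function, not only at t. *)
  - rewrite (_ : coord p a \o _ = cst 0); last first.
      by apply/funext => s /=; rewrite coord_tens// eq_sym (negbTE ai) mulr0.
    by rewrite derive1_cst !mul0r addr0 mulr0.
  - by rewrite coord_tens// eq_sym (negbTE bi) !mulr0 addr0 mulr0.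
congr (_ + _); apply: eq_Rintegral => z _; rewrite sum2.
- by rewrite !coord_tens// eqxx !mulr1 mulrA.
- move=> a b; rewrite xpair_eqE negb_and !coord_tens// ![i == _]eq_sym.
  by case/orP => /negbTE ->; rewrite !mulr0 ?mul0r.
- by rewrite !coord_tens// eqxx !mulr1 expr2 mulrA.
- move=> a b; rewrite xpair_eqE negb_and !coord_tens// ![i == _]eq_sym.
  by case/orP => /negbTE ->; rewrite !mulr0 ?mul0r.
Qed.

(** * From L_p classes to boundedness, integrability and measurability on a set *)

Lemma in_Lp_bounded d (T : measurableType d) (R : realType)
    (mu : {measure set T -> \bar R}) (D : set T) (h : T -> R) (N : R) :
  measurable D -> measurable_fun D h ->
  (forall x, D x -> `|h x| <= N) -> in_Lp mu D +oo%E h.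
Proof.
move=> mD mh hN; rewrite /in_Lp inE; apply/andP; split; rewrite inE /=.
  exact/(measurable_restrictT _ _).1.
rewrite /finite_norm unlock; case: ifP => // _.
(* The zero extension must also obey the bound off D, while N may be negative if D is empty; hence
   |N|. *)
apply: (@le_lt_trans _ _ `|N|%:E); last exact: ltry.
apply: ess_sup_ler => t /=; rewrite lee_fin patchE.
case: ifPn => [/set_mem tD|_]; last by rewrite normr0.
by rewrite (le_trans (hN t tD))// ler_norm.
Qed.

Lemma in_Lp1_integrable d (T : measurableType d) (R : realType)
    (mu : {measure set T -> \bar R}) (D : set T) (f : T -> R) :
  measurable D -> in_Lp mu D 1%:E f -> mu.-integrable D (EFin \o f).
Proof.
move=> mD /Lfun1_integrable fi.
by apply/(integrable_mkcond _ mD); rewrite restrict_EFin.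
Qed.

Lemma in_Lp_measurable d (T : measurableType d) (R : realType)
    (mu : {measure set T -> \bar R}) (D : set T) (p : \bar R) (f : T -> R) :
  measurable D -> in_Lp mu D p f -> measurable_fun D f.
Proof.
rewrite /in_Lp inE => mD /andP[]; rewrite inE /= => mf _.
exact/(measurable_restrictT _ _).2.
Qed.

(** * Comparison of the two traces, direction by direction *)

Lemma levy_trace_intE (R : realType) (d : nat) (g : metric_kind) (k : kernels R d) :
  admissible_kernels k ->
  levy_trace_int g k = \sum_i (if i == ord0 then 1 else metric_sign R g) *
    \int[@lebesgue_measure R]_(t in `[0, 1]) kerL k i i t.
Proof.
move=> [kint _].
have mI : measurable (`[0, 1] : set (measurableTypeR R)).
  exact: measurable_itv.
have iL i : (@lebesgue_measure R).-integrable `[0, 1] (EFin \o kerL k i i).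
  by apply: in_Lp1_integrable => //; exact: (kint i i).2.1.
(* A diagonal matrix with entries 1 and -1 is its own inverse. *)
have invG : invmx (metric_mx R d g) = metric_mx R d g.
  have GG : metric_mx R d g *m metric_mx R d g = 1%:M.
    rewrite /metric_mx mulmx_diag -diag_const_mx; congr diag_mx.
    apply/rowP => i; rewrite !mxE; case: ifP; rewrite ?mulr1//.
    by case: g; rewrite ?mulr1// mulrNN mulr1.
  have [Gu _] := mulmx1_unit GG.
  by rewrite -[LHS]mulmx1 -GG mulKmx.
rewrite /levy_trace_int invG.
under eq_Rintegral => t _.
  under eq_bigr => i _.
    rewrite (bigD1 i)//= big1 ?addr0; last first.
      by move=> j ji; rewrite !mxE [i == j]eq_sym (negbTE ji) mulr0n mulr0.
    rewrite !mxE eqxx mulr1n mulrC; over.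
  over.
rewrite (Rintegral_sum (index_enum 'I_d.+1) (mu := @lebesgue_measure R)
  (F := fun i t =>
    (if i == ord0 then 1 else metric_sign R g) * kerL k i i t))//.
- by apply: eq_bigr => i _; rewrite RintegralZl//; exact: measurable_itv.
- move=> i.
  by have := integrableZl mI (if i == ord0 then 1 else metric_sign R g) (iL i).
Qed.

(** Exchanging the sums lets the limit be taken separately in each direction p_i. *)
Lemma levy_meansE (R : realType) (d : nat) (p : d.+1.-tuple 'rV[R]_d.+1)
    (e : nat -> R -> R) (g : metric_kind)
    (Q : (R -> 'rV[R]_d.+1) -> (R -> 'rV[R]_d.+1) -> R) (n : nat) :
  levy_means p e g Q n = \sum_i (if i == ord0 then 1 else metric_sign R g) *
    (n%:R^-1 *
     \sum_(k < n) Q (tens (tnth p i) (e k)) (tens (tnth p i) (e k))).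
Proof.
rewrite /levy_means; under [RHS]eq_bigr do rewrite mulrCA mulr_sumr.
rewrite -mulr_sumr exchange_big /=; congr (_ * _); apply: eq_bigr => k _.
rewrite [RHS](bigD1 ord0)//= mul1r; congr (_ + _).
by rewrite mulr_sumr; apply: eq_bigr => i /negbTE ->.
Qed.

Lemma cvg_levy_means (R : realType) (d : nat) (K : space_kind) (g : metric_kind)
    (p : d.+1.-tuple 'rV[R]_d.+1) (e : nat -> R -> R)
    (Q : (R -> 'rV[R]_d.+1) -> (R -> 'rV[R]_d.+1) -> R) (k : kernels R d) :
  orthonormal_tuple p -> L2_orthonormal_basis e -> weakly_uniformly_dense e ->
  (forall n, spaceE1 K (e n)) -> (forall n, e n 1 = 0) -> uniformly_bounded01 e ->
  represents K p k Q ->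
  levy_means p e g Q n @[n --> \oo] --> levy_trace_int g k.
Proof.
move=> hp [e2 [eo _]] wud eE1 e1 ebnd [kadm Qk].
have mI : measurable (`[0, 1] : set (measurableTypeR R)).
  exact: measurable_itv.
have I01 : (lebesgue_measure (`[0%R, 1%R] : set R) < +oo)%E.
  by rewrite lebesgue_measure_itv /= lte_fin ltr01 oppr0 adde0 ltry.
have me n : measurable_fun (`[0, 1] : set (measurableTypeR R)) (e n).
  exact: in_Lp_measurable (e2 n).
rewrite levy_trace_intE//; under eq_fun do rewrite levy_meansE.
apply: cvg_big => [|i _]; first exact: add_continuous.
apply: cvgMl_tmp.
have [kV [kL _]] := kadm.1 i i.
have E0 j : spaceE0 K (tens (tnth p i) (e j)) by exact: spaceE0_tens.
(* The limit is split as 0 from the V-part plus int L_ii from the L-part. *)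
rewrite -[X in _ --> X]add0r.
under eq_fun => n.
  under eq_bigr => j _ do rewrite (Qk _ _ (E0 j) (E0 j)) kernel_form_tens//.
  rewrite big_split mulrDr; over.
apply: cvgD.
- have [M eM] := ebnd.
  have iV := in_Lp1_integrable (measurableX mI mI) kV.
  exact: (cvg_diagonal_means mI me eM I01 eo iV).
- have [M eM] := ebnd.
  have iL := in_Lp1_integrable mI kL.
  apply: (cvg_sqr_means mI me eM I01 _ iL).
  by move=> h N mh hN; apply: wud; exact: in_Lp_bounded hN.
Qed.

(** Any representing kernels give convergence, and T^2_E supplies some. Uniqueness of limits then
    yields the value for every choice, so the integral trace is independent of the kernels. *)
Theorem theorem1 (R : realType) (d : nat) (K : space_kind) (g : metric_kind)
    (p : d.+1.-tuple 'rV[R]_d.+1) (hp : orthonormal_tuple p)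
    (e : nat -> R -> R)
    (he_basis : L2_orthonormal_basis e)
    (he_wud : weakly_uniformly_dense e)
    (he_E1 : forall n, spaceE1 K (e n))
    (he_1 : forall n, e n 1%R = 0%R)
    (he_bnd : uniformly_bounded01 e)
    (Q : (R -> 'rV[R]_d.+1) -> (R -> 'rV[R]_d.+1) -> R)
    (hQ : T2E K p Q) :
  levy_trace_dom p e g Q /\
  (forall k : kernels R d, represents K p k Q ->
     levy_trace p e g Q = levy_trace_int g k).
Proof.
have cvgQ k : represents K p k Q ->
    levy_means p e g Q n @[n --> \oo] --> levy_trace_int g k.
  exact: cvg_levy_means.
split; last by move=> k /cvgQ/cvg_lim; apply.
by have [_ [k /cvgQ kcvg]] := hQ; apply/cvg_ex; exists (levy_trace_int g k).
Qed.
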